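(* Let $\mathcal{B}\subset\mathbb{M}_r$ be a matrix ring and $\pi:\mathbb{M}_r\to\mathbb{M}_r$ a positive linear map with $\pi\circ\pi=\pi$ and $\pi(\mathbb{M}_r)=\mathcal{B}$, such that $$\forall Q\in\mathbb{M}_r,\ \forall B\in\mathcal{B}\qquad \pi\left(B[Q-\pi(Q)]+[Q-\pi(Q)]B\right)=0,$$ and assume $A,A',R,S\in\mathcal{B}$. Then for any $Q_1,Q_2\in\mathbb{S}_r^+$ and any $t\ge0$, $$\Vert\phi^\pi_t(Q_2)-\phi^\pi_t(Q_1)\Vert_2\le\kappa_{\phi^\pi}(Q_1,Q_2)\,e^{-2\nu t}\left[\Vert\pi(Q_2)-\pi(Q_1)\Vert_2+e^{-2\nu t}\Vert Q_2-Q_1\Vert_2\right]$$ for some finite constant $\kappa_{\phi^\pi}(Q_1,Q_2)$ whose value depends only on $(\Vert Q_1\Vert_2,\Vert Q_2\Vert_2)$ (the system matrices and $\pi$ being fixed). This implies the existence of a unique fixed point $P^\pi=\phi^\pi_t(P^\pi)$ (for all $t\ge0$), with $\pi(P^\pi)=P$. In addition, for any $Q\in\mathbb{S}_r^+$ and $t\ge0$, $$\Vert\pi[\phi^\pi_t(Q)]-\phi^\pi_t(Q)\Vert_2\le\kappa_{\phi^\pi}(Q,\pi(Q))\,e^{-4\nu t}\,\Vert\pi(Q)-Q\Vert_2 .$$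
   Context: Notation: $\mathbb{M}_r$ = real $r\times r$ matrices, $\mathbb{S}_r^+\subset\mathbb{S}_r$ = symmetric positive semi-definite (resp. symmetric) matrices, $'$ = transpose, $\Vert\cdot\Vert_2$ = spectral norm. A map $\pi$ on $\mathbb{M}_r$ is positive if $\pi(\mathbb{S}_r^+)\subseteq\mathbb{S}_r^+$. Standing setting: $A\in\mathbb{M}_r$, $C$ is a real $r'\times r$ matrix, $R\in\mathbb{S}_r^+$ and $\Sigma\in\mathbb{S}_{r'}^+$ are positive definite, $S:=C'\Sigma^{-1}C$; $(A,R^{1/2})$ is controllable and $(A,C)$ is observable. $\mathrm{Ricc}(Q)=AQ+QA'-QSQ+R$; $\phi_t(Q)$ solves $\partial_t\phi_t(Q)=\mathrm{Ricc}(\phi_t(Q))$, $\phi_0(Q)=Q$; $P$ is the unique positive definite solution of $\mathrm{Ricc}(P)=0$. $\phi^\pi_t(Q)$ solves $\partial_t\phi^\pi_t(Q)=\mathrm{Ricc}^\pi(\phi^\pi_t(Q))$, $\phi^\pi_0(Q)=Q$, with $\mathrm{Ricc}^\pi(Q)=[A-\pi(Q)S]Q+Q[A-\pi(Q)S]'+R+\pi(Q)S\pi(Q)$. Rate $\nu$: let $E_t(Q)$ solve $\partial_tE_t(Q)=(A-\phi_t(Q)S)E_t(Q)$, $E_0(Q)=Id$. It is known that there are $\nu>0$ and finite non-decreasing functions $\kappa_E(q_1),\kappa_E(q_1,q_2),\kappa_\phi(q_1,q_2)$, depending only on $(A,R,S)$, with $\Vert E_t(Q_1)\Vert_2\le\kappa_E(\Vert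 Q_1\Vert_2)e^{-2\nu t}$, $\Vert\phi_t(Q_2)-\phi_t(Q_1)\Vert_2\le\kappa_\phi(\Vert Q_1\Vert_2,\Vert Q_2\Vert_2)e^{-2\nu t}\Vert Q_2-Q_1\Vert_2$ and $\Vert E_t(Q_2)-E_t(Q_1)\Vert_2\le\kappa_E(\Vert Q_1\Vert_2,\Vert Q_2\Vert_2)e^{-\nu t}\Vert Q_2-Q_1\Vert_2$; $\nu$ is this fixed rate. *)

(* Defs.v *)
From HB Require Import structures.
From mathcomp Require Export all_boot all_order all_algebra.
From mathcomp Require Export all_classical all_reals all_analysis.
Export Order.TTheory GRing.Theory Num.Theory.
Export numFieldNormedType.Exports.

Set Implicit Arguments.
Unset Strict Implicit.
Unset Printing Implicit Defensive.

Local Open Scope classical_set_scope.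
Local Open Scope ring_scope.

Section Defs.
Variable K : realType.

Definition euclid_norm n (x : 'cV[K]_n) : K := Num.sqrt (\sum_i x i 0 ^+ 2).

(* The set is nonempty and bounded above, so this sup is a genuine supremum. *)
Definition spectral_norm n (M : 'M[K]_n) : K :=
  sup [set euclid_norm (M *m x) | x in [set x | euclid_norm x <= 1]].

Definition psd n (M : 'M[K]_n) : Prop :=
  M^T = M /\ forall x : 'cV[K]_n, 0 <= (x^T *m M *m x) 0 0.

Definition posdef n (M : 'M[K]_n) : Prop :=
  M^T = M /\ forall x : 'cV[K]_n, x != 0 -> 0 < (x^T *m M *m x) 0 0.

(* Kalman rank conditions on [B, A B, ..., A^(n-1) B] and its dual. *)
Definition controllable n m (A : 'M[K]_n) (B : 'M[K]_(n, m)) : Prop :=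
  \rank (\mxrow_(i < n) (A ^+ i *m B)) = n.

Definition observable n m (A : 'M[K]_n) (C : 'M[K]_(m, n)) : Prop :=
  \rank (\mxcol_(i < n) (C *m A ^+ i)) = n.

Definition Ricc n (A R S Q : 'M[K]_n) : 'M[K]_n :=
  A *m Q + Q *m A^T - Q *m S *m Q + R.

Definition Ricc_pi n (pi : 'M[K]_n -> 'M[K]_n) (A R S Q : 'M[K]_n) : 'M[K]_n :=
  (A - pi Q *m S) *m Q + Q *m (A - pi Q *m S)^T + R + pi Q *m S *m pi Q.

(* X' = F(t, X) on [0, +oo[, with a right derivative at t = 0. *)
Definition ode_solution n (F : K -> 'M[K]_n -> 'M[K]_n) (X0 : 'M[K]_n)
    (X : K -> 'M[K]_n) : Prop :=
  [/\ X 0 = X0,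
      h^-1 *: (X h - X 0) @[h --> 0^'+] --> F 0 (X 0) &
      forall t : K, 0 < t -> is_derive t (1 : K) X (F t (X t))].

Definition is_flow n (F : 'M[K]_n -> 'M[K]_n) (phi : K -> 'M[K]_n -> 'M[K]_n) :=
  forall Q, psd Q -> ode_solution (fun=> F) Q (phi^~ Q).

Definition is_transition n (A S : 'M[K]_n) (phi E : K -> 'M[K]_n -> 'M[K]_n) :=
  forall Q, psd Q ->
    ode_solution (fun t X => (A - phi t Q *m S) *m X) 1%:M (E^~ Q).

Definition ndecr1 (k : K -> K) : Prop :=
  forall q q', 0 <= q -> q <= q' -> k q <= k q'.

Definition ndecr2 (k : K -> K -> K) : Prop :=
  forall q1 q2 q1' q2', 0 <= q1 -> 0 <= q2 -> q1 <= q1' -> q2 <= q2' ->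
    k q1 q2 <= k q1' q2'.

(* kE1 and kE2 are the one- and two-argument functions both written kappa_E. *)
Definition is_rate n (phi E : K -> 'M[K]_n -> 'M[K]_n) (nu : K) : Prop :=
  0 < nu /\
  exists (kE1 : K -> K) (kE2 kphi : K -> K -> K),
    [/\ ndecr1 kE1, ndecr2 kE2 & ndecr2 kphi] /\
    forall Q1 Q2, psd Q1 -> psd Q2 -> forall t : K, 0 <= t ->
      let q1 := spectral_norm Q1 in
      let q2 := spectral_norm Q2 in
      let d := spectral_norm (Q2 - Q1) in
      [/\ spectral_norm (E t Q1) <= kE1 q1 * expR (- (2 * nu * t)),
          spectral_norm (phi t Q2 - phi t Q1)
            <= kphi q1 q2 * expR (- (2 * nu * t)) * d &
          spectral_norm (E t Q2 - E t Q1)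
            <= kE2 q1 q2 * expR (- (nu * t)) * d].

(* No unit is required of the ring: the identity matrix is not assumed in B. *)
Definition matrix_ring n (B : set 'M[K]_n) : Prop :=
  zmod_closed (mem B) /\ GRing.mulr_2closed (mem B).

End Defs.

(* Main.v *)
Require Import Defs.
From mathcomp Require Import ring lra.

(** The map [pi] intertwines the two drifts on symmetric matrices:
    [pi (Ricc_pi Q) = Ricc (pi Q)].  Since [pi_compat] only controls Jordan
    products, this needs [pi (a D) = 0] for [D] symmetric in the kernel of [pi]
    and [a] antisymmetric in the range.  The map [b |-> pi (b D)] turns out to be
    a Jordan derivation of the range which vanishes on commutators; when such a
    map takes a symmetric value at an antisymmetric [a], this value is zero.

    Hence [pi (phipi t Q) = phi t (pi Q)], and the difference [phipi - pi phipi]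
    solves the linear equation [W' = b W + W b^T] with [b = A - phi t (pi Q) S],
    so that [phipi t Q = phi t (pi Q) + E t (pi Q) (Q - pi Q) (E t (pi Q))^T].
    All estimates follow from this formula.  Finally [pi P = P], because [P] is
    the limit of [phi t (pi P)], which stays in the range of [pi]; so [P] is the
    fixed point. *)

Set Implicit Arguments.
Unset Strict Implicit.
Unset Printing Implicit Defensive.

Local Open Scope classical_set_scope.
Local Open Scope ring_scope.

(** * Jordan derivations and positive projections *)

Lemma addmxE (V : nmodType) m n (X Y : 'M[V]_(m, n)) i j : (X + Y) i j = X i j + Y i j.
Proof. by rewrite mxE. Qed.

Lemma oppmxE (V : zmodType) m n (X : 'M[V]_(m, n)) i j : (- X) i j = - X i j.
Proof. by rewrite mxE. Qed.

Lemma scalemxE (F : pzRingType) m n c (X : 'M[F]_(m, n)) i j : (c *: X) i j = c * X i j.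
Proof. by rewrite mxE. Qed.

Lemma zeromxE (V : nmodType) m n i j : (0 : 'M[V]_(m, n)) i j = 0.
Proof. by rewrite mxE. Qed.

Lemma trmx_add (V : nmodType) m n (X Y : 'M[V]_(m, n)) : (X + Y)^T = X^T + Y^T.
Proof. exact: raddfD. Qed.

Lemma trmx_opp (V : zmodType) m n (X : 'M[V]_(m, n)) : (- X)^T = - X^T.
Proof. exact: raddfN. Qed.

(* Linear identities between matrix products, with the entries of the monomials
   as atoms. *)
Ltac mx_expand :=
  rewrite ?(mulmxDl, mulmxDr, mulmxBl, mulmxBr, mulNmx, mulmxN, opprD, opprK,
    mulmxA, mul0mx, mulmx0, addr0, add0r, oppr0).
Ltac mx_linear :=
  mx_expand; apply/matrixP => ? ?; rewrite ?(addmxE, oppmxE, scalemxE, zeromxE); lra.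

Section JordanDerivation.
Variables (K : realFieldType) (n : nat).
Implicit Types (a b c N : 'M[K]_n) (B : 'M[K]_n -> Prop).

(** This trace is the sum of the squares of the entries of [N]. *)
Lemma mxtrace_gram_eq0 N : \tr (N^T *m N) = 0 -> N = 0.
Proof.
rewrite /mxtrace => N0; apply/matrixP => i j; rewrite mxE.
have ge0 (k : 'I_n) : 0 <= (N^T *m N) k k.
  by rewrite mxE sumr_ge0// => l _; rewrite mxE -expr2 sqr_ge0.
move/eqP: N0; rewrite psumr_eq0 => [|k _]; last exact: ge0.
move=> /allP/(_ j (mem_index_enum _))/=; rewrite mxE psumr_eq0 => [|l _].
  move=> /allP/(_ i (mem_index_enum _))/=; rewrite mxE mulf_eq0 orbb.
  by move/eqP.
by rewrite mxE -expr2 sqr_ge0.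
Qed.

Lemma gram_eq0 N : N^T *m N = 0 -> N = 0.
Proof. by move=> N0; apply: mxtrace_gram_eq0; rewrite N0 mxtrace0. Qed.

Lemma mulr2n_mx_inj b c : b *+ 2 = c *+ 2 -> b = c.
Proof.
rewrite -(scaler_nat 2 b) -(scaler_nat 2 c) => /scalerI; apply.
by rewrite pnatr_eq0.
Qed.

(** The left side is twice [f (b *m c)], not [f (b *m c + c *m b)]. As the right side is symmetric
    in [b] and [c], this stronger form also makes an additive [f] vanish on commutators. *)
Definition jordan_derivation B (f : 'M[K]_n -> 'M[K]_n) :=
  forall b c, B b -> B c ->
    f (b *m c) *+ 2 = b *m f c + f c *m b + (c *m f b + f b *m c).

Lemma jordan_derivationC B (f : 'M[K]_n -> 'M[K]_n) b c :
  jordan_derivation B f -> B b -> B c -> f (b *m c) = f (c *m b).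
Proof.
move=> fJ Bb Bc; apply: mulr2n_mx_inj.
exact: etrans (fJ b c Bb Bc) (etrans (addrC _ _) (esym (fJ c b Bc Bb))).
Qed.

(* Since [f] vanishes on commutators, it vanishes on [y] and on [a *m y] where
   [y = [[a, g], a]]; hence the trace of [y *m g], which is that of
   [[a, g] ^ 2], is zero. *)
Lemma jordan_derivation_comm B (f : {linear 'M[K]_n -> 'M[K]_n}) a :
  (forall b c, B b -> B c -> B (b - c)) ->
  (forall b c, B b -> B c -> B (b *m c)) ->
  (forall b, B b -> B (f b)) -> jordan_derivation B f ->
  B a -> a^T = - a -> (f a)^T = f a -> comm_mx a (f a).
Proof.
move=> BB BM Bf fJ Ba aT; set g := f a => gT.
have Bg : B g by exact: Bf.
pose z := a *m g - g *m a; pose y := z *m a - a *m z.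
have Bz : B z by apply: BB; exact: BM.
have By : B y by apply: BB; exact: BM.
have fy : f y = 0.
  by rewrite linearB/= (jordan_derivationC fJ Bz Ba) subrr.
have fay : f (a *m y) = 0.
  have -> : a *m y = (a *m z) *m a - a *m (a *m z).
    by rewrite mulmxBr !mulmxA.
  rewrite linearB/= (jordan_derivationC fJ (BM _ _ Ba Bz) Ba) subrr//.
have zT : z^T = z.
  by rewrite /z linearB/= !trmx_mul aT gT mulmxN mulNmx opprK addrC.
have yg : \tr (y *m g) = 0.
  have := fJ a y Ba By; rewrite fay fy mul0rn mulmx0 mul0mx !add0r -/g.
  move/(congr1 mxtrace); rewrite mxtrace0 mxtraceD [\tr (g *m y)]mxtrace_mulC.
  by move=> /esym/eqP; rewrite -mulr2n mulrn_eq0 /= => /eqP.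
(* As [z] is symmetric, the trace of [z^T z] is that of [z (a g - g a)], which by cyclicity is that
   of [(z a - a z) g = y g]. *)
apply/subr0_eq; rewrite -/z; apply: mxtrace_gram_eq0.
rewrite zT {2}/z mulmxBr linearB/= mulmxA [\tr (z *m (g *m a))]mxtrace_mulC.
by rewrite -[g *m a *m z]mulmxA [\tr (g *m _)]mxtrace_mulC -linearB/= -mulmxBl.
Qed.

End JordanDerivation.

(* Here [f (q(a)) = q'(a) *m f a], so that [q(a) *m f a = 0] entails
   [q'(a) *m f a = 0]; differentiate the characteristic polynomial until it is
   a nonzero constant. *)
Lemma jordan_derivation_comm_eq0 (K : realFieldType) (n : nat)
    (B : 'M[K]_n -> Prop) (f : {linear 'M[K]_n -> 'M[K]_n}) (a : 'M[K]_n) :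
  (forall b c, B b -> B c -> B (b *m c)) ->
  (forall b, B b -> B (f b)) -> jordan_derivation B f ->
  B a -> a^T = - a -> (f a)^T = f a -> comm_mx a (f a) -> f a = 0.
Proof.
case: n B f a => [|n] B f a BM Bf fJ Ba aT; first by rewrite [f a]flatmx0.
set g := f a => gT ag.
have Bg : B g by exact: Bf.
have agq (q : {poly K}) : GRing.comm (horner_mx a q) g.
  by apply/comm_mx_sym/comm_mx_horner/comm_mx_sym.
have Bak k : B (a ^+ k.+1).
  by elim: k => [|k IHk]; rewrite ?expr1// exprS; apply: BM.
have agk k : a ^+ k * g = g * a ^+ k by rewrite (commrX k (commr_sym ag)).
have fak k : f (a ^+ k.+1) = (a ^+ k * g) *+ k.+1.
  elim: k => [|k IHk]; first by rewrite expr1 expr0 mul1r.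
  apply: mulr2n_mx_inj; rewrite exprS fJ//= IHk -/g !mulmxE.
  rewrite !mulrnAl !mulrnAr !mulrA -exprS -(agk k.+1) -mulrA -(ag : a * g = g * a).
  by rewrite mulrA -exprSr [X in _ = X *+ 2]mulrS mulrnDl !mulr2n addrC.
(* For [k = 0] the truncated exponent [k.-1] is harmless, since its term is multiplied by [k]. *)
have fag k : f (a ^+ k * g) *+ 2 =
    a ^+ k * f g + f g * a ^+ k + (a ^+ k.-1 * (g * g) *+ k) *+ 2.
  case: k => [|k]; first by rewrite expr0 !mul1r mulr1 mulr0n mul0rn addr0 mulr2n.
  rewrite (fJ (a ^+ k.+1) g)// fak !mulmxE !(mulrnAl, mulrnAr) /=.
  by rewrite [g * (_ * g)]mulrA -agk -!mulrA [in RHS]mulr2n.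
have hornerZX b c k : horner_mx b (c *: 'X^k) = c *: b ^+ k.
  by rewrite linearZ/= rmorphXn/= horner_mx_X.
have fqg (q : {poly K}) : f (horner_mx a q * g) *+ 2 =
    horner_mx a q * f g + f g * horner_mx a q
    + (horner_mx a q^`() * (g * g)) *+ 2.
  rewrite -[q]coefK poly_def !raddf_sum/=.
  rewrite !(mulr_suml, mulr_sumr) linear_sum /= -!sumrMnl -!big_split/=.
  apply: eq_bigr => i _; rewrite hornerZX derivZ derivXn.
  rewrite -(scaler_nat i ('X^(i.-1) : {poly K})) scalerA.
  rewrite hornerZX -!scalerAl -scalerAr linearZ/= -scalerA scaler_nat.
  by rewrite !scalerMnr fag !scalerDr.
have dq (q : {poly K}) : horner_mx a q * g = 0 -> horner_mx a q^`() * g = 0.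
  move=> qg0; set q' := horner_mx a _.
  (* Since [a] is antisymmetric, the transpose of [q'] is a polynomial in [- a], and so commutes
     with every polynomial in [a]. *)
  have q'T : q'^T = horner_mx (- a) q^`().
    rewrite /q' -[q^`()]coefK poly_def !rmorph_sum linear_sum /=.
    apply: eq_bigr => i _. rewrite !hornerZX linearZ/=.
    congr (_ *: _); elim: (i : nat) => [|j IHj]; first by rewrite !expr0 trmx1.
    by rewrite exprSr trmx_mul IHj aT exprS.
  have q'T_comm : GRing.comm q'^T (horner_mx a q).
    rewrite q'T; apply: comm_horner_mx; apply: comm_mx_horner.
    by rewrite /comm_mx mulNmx mulmxN.
  (* [X] is the transpose of [q' * (g * g)] and annihilates [q(a)] on both sides. In the trace of
     [X] times [fqg], the two terms in [f g] therefore vanish by cyclicity, and what remains is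
     twice the sum of squares of the entries of [q' * (g * g)]. *)
  pose X := g * g * q'^T.
  have Xq0 : X * horner_mx a q = 0.
    rewrite /X -mulrA q'T_comm -mulrA (mulrA g (horner_mx a q)) -agq qg0.
    by rewrite !(mul0r, mulr0).
  have qX0 : horner_mx a q * X = 0.
    by rewrite /X !mulrA qg0 !mul0r.
  have trX : \tr (X *m (q' * (g * g))) = 0.
    have := fqg q; rewrite qg0 linear0 mul0rn => /esym.
    move/(congr1 (fun M => \tr (X *m M))); rewrite mulmx0 mxtrace0.
    rewrite !mulmxDr !linearD/= !mulmxE !mulrA Xq0 mul0r linear0 add0r.
    rewrite -mulmxE [\tr (X *m f g *m _)]mxtrace_mulC !mulmxE mulrA qX0.
    rewrite mul0r linear0 add0r -mulr2n => /eqP.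
    by rewrite mulrn_eq0 -!mulrA => /eqP.
  have Ng2 : q' * (g * g) = 0.
    by apply: mxtrace_gram_eq0; rewrite !trmx_mul gT.
  apply: gram_eq0; rewrite {1}agq trmx_mul gT !mulmxE -mulrA (mulrA g q').
  by rewrite -agq -mulrA Ng2 mulr0.
have lead k (q : {poly K}) : horner_mx a q * g = 0 ->
    horner_mx a q^`(k) * g = 0.
  by elim: k => [|k IHk] // /IHk /dq; rewrite derivnS.
have /(lead n.+1) : horner_mx a (char_poly a) * g = 0.
  by rewrite Cayley_Hamilton mul0r.
have -> : (char_poly a)^`(n.+1) = (n.+1)`!%:R.
  apply/polyP => i; rewrite coef_derivn coefMn coef1.
  have := size_char_poly a; have := char_poly_monic a.
  case: i => [|i]; rewrite ?(addn0, ffactnn).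
    by rewrite monicE lead_coefE => /eqP mon sz; move: mon; rewrite sz => ->.
  by move=> _ sz; rewrite nth_default ?mul0rn// sz addnS ltnS leq_addr.
rewrite rmorph_nat mulr_natl -scaler_nat => /eqP.
by rewrite scaler_eq0 pnatr_eq0 eqn0Ngt fact_gt0 => /eqP.
Qed.

(** * Positive projections onto a matrix ring *)

Section PositiveProjection.
Variables (K : realType) (n : nat) (B : 'M[K]_n -> Prop).
Variable pi : {linear 'M[K]_n -> 'M[K]_n}.
Hypothesis BB : forall b c, B b -> B c -> B (b - c).
Hypothesis BM : forall b c, B b -> B c -> B (b *m c).
Hypothesis pi_in : forall Q, B (pi Q).
Hypothesis pi_id : forall b, B b -> pi b = b.
Hypothesis pi_positive : forall Q, psd Q -> psd (pi Q).
Hypothesis pi_compat : forall Q b, B b ->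
  pi (b *m (Q - pi Q) + (Q - pi Q) *m b) = 0.

Lemma psd_scalar (c : K) : 0 <= c -> psd (c%:M : 'M[K]_n).
Proof.
move=> c0; split; first by rewrite tr_scalar_mx.
move=> x; rewrite mul_mx_scalar -scalemxAl scalemxE mulr_ge0// mxE.
by rewrite sumr_ge0// => i _; rewrite mxE -expr2 sqr_ge0.
Qed.

(** The shift is the sum of the absolute values of all entries: it dominates the quadratic form
    because each [|x_i x_j|] is at most the squared norm of [x]. *)
Lemma psd_add_scalar (M : 'M[K]_n) :
  M^T = M -> exists2 c, 0 <= c & psd (M + c%:M).
Proof.
move=> MT; pose m := \sum_i \sum_j `|M j i|; exists m.
  by apply: sumr_ge0 => i _; apply: sumr_ge0.
split; first by rewrite linearD/= MT tr_scalar_mx.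
move=> x; rewrite mulmxDr mulmxDl mxE mul_mx_scalar -scalemxAl scalemxE.
set s := (x^T *m x) 0 0.
have xs i : x i 0 ^+ 2 <= s.
  rewrite /s mxE (bigD1 i)//= mxE -expr2 lerDl sumr_ge0// => j _.
  by rewrite mxE -expr2 sqr_ge0.
suff : `|(x^T *m M *m x) 0 0| <= m * s.
  by rewrite ler_norml => /andP[+ _]; rewrite -subr_ge0 opprK.
rewrite mxE (le_trans (ler_norm_sum _ _ _))// /m big_distrl/= ler_sum// => i _.
rewrite mxE !big_distrl/= (le_trans (ler_norm_sum _ _ _))// ler_sum// => j _.
rewrite mxE [x j 0 * _]mulrC -mulrA normrM ler_wpM2l// ler_norml.
have := xs i; have := xs j; have := sqr_ge0 (x i 0 + x j 0).
by have := sqr_ge0 (x i 0 - x j 0); nra.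
Qed.

(** A symmetric matrix is a difference of two positive semi-definite ones, whose images are
    symmetric by positivity. *)
Lemma positive_trmx (Q : 'M[K]_n) : Q^T = Q -> (pi Q)^T = pi Q.
Proof.
move=> /psd_add_scalar[c c0 /pi_positive[Qc _]].
have [cT _] := pi_positive (psd_scalar c0).
by apply: (addIr (pi c%:M)); rewrite -{1}cT -!linearD/= Qc.
Qed.

(** Compatibility says that [pi (e *m M) = - pi (M *m e)] for [M] in the kernel and [e] in [B]. Use
    it for [c *m D - fc] with [b], and for [D *m b + fb] with [c]. On subtracting, the term
    [pi (c *m D *m b)] cancels, and [pi (D *m (b *m c))] is [- pi (b *m c *m D)]. *)
Lemma projection_jordan_derivation (D : 'M[K]_n) : pi D = 0 ->
  jordan_derivation B (fun b => pi (b *m D)).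
Proof.
move=> D0 b c Bb Bc.
have swap (e M : 'M[K]_n) : B e -> pi M = 0 -> pi (e *m M) + pi (M *m e) = 0.
  by move=> Be M0; rewrite -linearD -(pi_compat M Be) M0 subr0.
set fb := pi (b *m D); set fc := pi (c *m D).
have fbE : pi (D *m b) = - fb.
  by apply/eqP; rewrite -addr_eq0 addrC; apply/eqP/swap.
have pi_id2 e Q : B e -> pi (e *m pi Q) = e *m pi Q.
  by move=> Be; apply/pi_id/BM.
have pi_id3 e Q : B e -> pi (pi Q *m e) = pi Q *m e.
  by move=> Be; apply/pi_id/BM.
have := swap b (c *m D - fc) Bb _; rewrite linearB/= (pi_id (pi_in _)) subrr.
move=> /(_ erefl).
have := swap c (D *m b + fb) Bc _; rewrite linearD/= fbE (pi_id (pi_in _)) addNr.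
move=> /(_ erefl).
have fbcE : pi (D *m (b *m c)) = - pi (b *m c *m D).
  by apply/eqP; rewrite -addr_eq0 addrC; apply/eqP/swap => //; apply: BM.
rewrite !(mulmxDl, mulmxDr, mulNmx, mulmxN) !(linearD, linearN)/=.
rewrite !(pi_id2, pi_id3)// -(mulmxA D) fbcE !mulmxA mulr2n -/fb -/fc => h1 h2.
apply/matrixP => i j; move/matrixP: h1 => /(_ i j); move/matrixP: h2 => /(_ i j).
rewrite ?(addmxE, oppmxE, zeromxE) => ? ?; lra.
Qed.

(** The Jordan derivation [b |-> pi (b *m D)] takes a symmetric value at [c]: twice this value is
    the image of the symmetric matrix [c *m D - D *m c]. *)
Lemma projection_antisym (D c : 'M[K]_n) :
  pi D = 0 -> D^T = D -> B c -> c^T = - c -> pi (c *m D) = 0.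
Proof.
move=> D0 DT Bc cT; pose f : {linear 'M[K]_n -> 'M[K]_n} := pi \o mulmxr D.
have fJ : jordan_derivation B f by exact: projection_jordan_derivation.
have Bf b : B b -> B (f b) by move=> _; exact: pi_in.
have fcT : (f c)^T = f c.
  apply: mulr2n_mx_inj; rewrite -raddfMn/=.
  have -> : pi (c *m D) *+ 2 = pi (c *m D - D *m c).
    rewrite linearB mulr2n; congr (_ + _); apply/eqP; rewrite -addr_eq0.
    by have := pi_compat D Bc; rewrite D0 subr0 linearD => ->.
  by apply: positive_trmx; rewrite linearB/= !trmx_mul DT cT mulmxN mulNmx opprK addrC.
apply: (jordan_derivation_comm_eq0 BM Bf fJ Bc cT fcT).
exact: (jordan_derivation_comm BB BM Bf fJ Bc cT fcT).
Qed.

(** With [b = A - p S] and [D = Q - p], the drift is [(b D + D b) + D (b^T - b) + Ricc p]. The first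
    term is killed by compatibility, the second by antisymmetry of [b^T - b], and the third is fixed
    by [pi] since it lies in [B]. *)
Lemma projection_Ricc_pi (A R S Q : 'M[K]_n) :
  B A -> B A^T -> B R -> B S -> S^T = S -> Q^T = Q ->
  pi (Ricc_pi pi A R S Q) = Ricc A R S (pi Q).
Proof.
move=> BA BAT BR BS ST QT; rewrite /Ricc_pi.
have pT := positive_trmx QT; set p := pi Q in pT *.
have Bp : B p by exact: pi_in.
pose b := A - p *m S; pose D := Q - p.
have bT : b^T = A^T - S *m p by rewrite /b linearB/= trmx_mul ST pT.
have Bb : B b by apply: BB => //; exact: BM.
have BbT : B b^T by rewrite bT; apply: BB => //; exact: BM.
have BN x : B x -> B (- x).
  by move=> Bx; rewrite -sub0r; apply: (BB _ Bx); rewrite -(subrr x); exact: BB.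
have BD x y : B x -> B y -> B (x + y).
  by move=> Bx By; rewrite -[y]opprK; apply: BB => //; exact: BN.
have D0 : pi D = 0 by rewrite linearB/= (pi_id Bp) subrr.
have DT : D^T = D by rewrite linearB/= QT pT.
have Bc : B (b^T - b) by exact: BB.
have cD0 : pi ((b^T - b) *m D) = 0.
  by apply: projection_antisym; rewrite // linearB/= trmxK opprB.
have : pi ((b^T - b) *m D + D *m (b^T - b)) = 0.
  by have := pi_compat D Bc; rewrite D0 subr0.
rewrite linearD/= cD0 add0r => Dc0.
have bD0 : pi (b *m D + D *m b) = 0 by have := pi_compat D Bb; rewrite D0 subr0.
have -> : (A - p *m S) *m Q + Q *m (A - p *m S)^T + R + p *m S *m p
    = (b *m D + D *m b) + D *m (b^T - b) + Ricc A R S p.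
  by rewrite -/b bT /Ricc /D /b; mx_linear.
rewrite linearD/= [X in X + _]linearD/= bD0 Dc0 !add0r pi_id//.
by rewrite /Ricc; apply: (BD _ _ _ BR); apply: BB; [apply: BD|]; repeat apply: BM.
Qed.

End PositiveProjection.

(** * Norms and scalar derivatives *)

Section MatrixNorm.
Variable K : realType.

Lemma mx_norm_entry m n (M : 'M[K]_(m, n)) i j : `|M i j| <= `|M|.
Proof. by rewrite [leRHS]/Num.Def.normr/= mx_normrE (le_bigmax _ _ (i, j)). Qed.

Lemma mx_norm_le m n (M : 'M[K]_(m, n)) e :
  0 <= e -> (forall i j, `|M i j| <= e) -> `|M| <= e.
Proof.
move=> e0 Me; rewrite [leLHS]/Num.Def.normr/= mx_normrE.
by apply: bigmax_le => // -[i j] _; exact: Me.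
Qed.

Lemma mx_norm_mul m n p (M : 'M[K]_(m, n)) (N : 'M[K]_(n, p)) :
  `|M *m N| <= n%:R * (`|M| * `|N|).
Proof.
apply: mx_norm_le => [|i j]; first by rewrite !mulr_ge0.
rewrite mxE (le_trans (ler_norm_sum _ _ _))//.
rewrite mulr_natl -[n in _ *+ n]card_ord -sumr_const ler_sum// => k _.
by rewrite normrM ler_pM// mx_norm_entry.
Qed.

Lemma mx_norm_trmx m n (M : 'M[K]_(m, n)) : `|M^T| = `|M|.
Proof.
apply/eqP; rewrite eq_le; apply/andP; split; apply: mx_norm_le => // i j.
  by rewrite mxE mx_norm_entry.
by have := mx_norm_entry M^T j i; rewrite mxE.
Qed.

Lemma linear_mx_entry m n p q (f : {linear 'M[K]_(m, n) -> 'M[K]_(p, q)}) M i j :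
  f M i j = \sum_k \sum_l M k l * f (delta_mx k l) i j.
Proof.
rewrite {1}(matrix_sum_delta M) linear_sum summxE; apply: eq_bigr => k _.
by rewrite linear_sum summxE; apply: eq_bigr => l _; rewrite linearZ/= mxE.
Qed.

Lemma linear_mx_bounded m n p q (f : {linear 'M[K]_(m, n) -> 'M[K]_(p, q)}) :
  exists2 c, 0 <= c & forall M, `|f M| <= c * `|M|.
Proof.
have c0 : 0 <= \sum_k \sum_l `|f (delta_mx k l)|.
  by apply: sumr_ge0 => k _; apply: sumr_ge0.
exists (\sum_k \sum_l `|f (delta_mx k l)|) => // M.
apply: mx_norm_le => [|i j]; first by rewrite mulr_ge0.
rewrite linear_mx_entry (le_trans (ler_norm_sum _ _ _))// big_distrl/=.
apply: ler_sum => k _.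
rewrite (le_trans (ler_norm_sum _ _ _))// big_distrl/= ler_sum// => l _.
by rewrite mulrC normrM ler_pM// mx_norm_entry.
Qed.

Lemma euclid_norm_entry n (x : 'cV[K]_n) i : `|x i 0| <= euclid_norm x.
Proof.
rewrite -sqrtr_sqr ler_sqrt; last by rewrite sumr_ge0// => j _; exact: sqr_ge0.
by rewrite (bigD1 i)//= lerDl sumr_ge0// => j _; exact: sqr_ge0.
Qed.

Lemma euclid_norm_le n (x : 'cV[K]_n) : euclid_norm x <= n%:R * `|x|.
Proof.
rewrite -[leRHS]ger0_norm ?mulr_ge0// -sqrtr_sqr ler_sqrt ?sqr_ge0//.
have n2 : n%:R <= n%:R ^+ 2 :> K 
  by rewrite -natrX ler_nat -mulnn; case: (n) => // k; exact: leq_pmulr.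
rewrite exprMn; apply: le_trans (ler_wpM2r (sqr_ge0 _) n2).
rewrite mulr_natl -[n in _ *+ n]card_ord -sumr_const ler_sum// => i _.
by rewrite -real_normK ?num_real// lerXn2r ?nnegrE// mx_norm_entry.
Qed.

Lemma euclid_norm_mul n (M : 'M[K]_n) (x : 'cV[K]_n) :
  euclid_norm x <= 1 -> euclid_norm (M *m x) <= n%:R ^+ 2 * `|M|.
Proof.
move=> x1; apply: (le_trans (euclid_norm_le _)).
rewrite expr2 -mulrA ler_wpM2l// (le_trans (mx_norm_mul _ _))// ler_wpM2l//.
rewrite ler_piMr// mx_norm_le// => i j.
by rewrite ord1 (le_trans (euclid_norm_entry _ _)).
Qed.

Let euclid_norm0 n : euclid_norm (0 : 'cV[K]_n) = 0.
Proof.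
by rewrite /euclid_norm big1 ?sqrtr0// => i _; rewrite mxE expr0n.
Qed.

(** With the converse bound below, this allows all estimates to be made in the entrywise maximum
    norm, at the price of a factor [n ^ 2]. *)
Lemma spectral_norm_le n (M : 'M[K]_n) : spectral_norm M <= n%:R ^+ 2 * `|M|.
Proof.
apply: ge_sup => [|_ [x x1 <-]]; last exact: euclid_norm_mul.
by exists (euclid_norm (M *m 0)); exists 0 => //=; rewrite euclid_norm0.
Qed.

Lemma spectral_norm_ge n (M : 'M[K]_n) : `|M| <= spectral_norm M.
Proof.
have le_sup (x : 'cV[K]_n) : euclid_norm x <= 1 ->
    euclid_norm (M *m x) <= spectral_norm M.
  move=> x1; apply: ub_le_sup; last by exists x.
  by exists (n%:R ^+ 2 * `|M|) => _ [y y1 <-]; exact: euclid_norm_mul.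
apply: mx_norm_le => [|i j].
  apply: le_trans (le_sup 0 _); last by rewrite euclid_norm0.
  by rewrite mulmx0 euclid_norm0.
(* The [j]-th basis vector extracts the [j]-th column of [M]. *)
apply: le_trans (le_sup (delta_mx j 0) _).
  by apply: le_trans (euclid_norm_entry _ i); rewrite -colE mxE.
rewrite /euclid_norm (bigD1 j)//= mxE !eqxx expr1n big1 ?addr0 ?sqrtr1// => k kj.
by rewrite mxE (negbTE kj) expr0n.
Qed.

End MatrixNorm.

Section ScalarDerivation.
Variable K : realType.
Implicit Types f g : K -> K.

(* [f' 0] is irrelevant. *)
Definition has_derivative f f' :=
  f t @[t --> 0^'+] --> f 0 /\ forall t : K, 0 < t -> is_derive t (1 : K) f (f' t).

Lemma has_derivative_cst (c : K) : has_derivative (fun=> c) (fun=> 0).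
Proof. by split=> [|t _]; [exact: cvg_cst|exact: is_derive_cst]. Qed.

Lemma has_derivativeD f f' g g' : has_derivative f f' -> has_derivative g g' ->
  has_derivative (fun t => f t + g t) (fun t => f' t + g' t).
Proof.
move=> [f0 df] [g0 dg]; split=> [|t t0]; first exact: cvgD.
by have ? := df t t0; have ? := dg t t0; apply: is_deriveD.
Qed.

Lemma has_derivativeM f f' g g' : has_derivative f f' -> has_derivative g g' ->
  has_derivative (fun t => f t * g t) (fun t => f' t * g t + f t * g' t).
Proof.
move=> [f0 df] [g0 dg]; split=> [|t t0]; first exact: cvgM.
have ? := df t t0; have ? := dg t t0; apply: (is_derive_eq (is_deriveM _ _)).
by rewrite addrC mulrC.
Qed.

Lemma has_derivative_sum (I : Type) (s : seq I) (F F' : I -> K -> K) :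
  (forall i, has_derivative (F i) (F' i)) ->
  has_derivative (fun t => \sum_(i <- s) F i t) (fun t => \sum_(i <- s) F' i t).
Proof.
move=> dF; elim: s => [|i s IHs].
  rewrite (_ : (fun t => \sum_(i <- [::]) F i t) = fun=> 0); last first.
    by apply/funext => t; rewrite big_nil.
  rewrite (_ : (fun t => \sum_(i <- [::]) F' i t) = fun=> 0); last first.
    by apply/funext => t; rewrite big_nil.
  exact: has_derivative_cst.
under eq_fun do rewrite big_cons.
under [X in has_derivative _ X]eq_fun do rewrite big_cons.
exact: has_derivativeD.
Qed.

Lemma has_derivative_continuous f f' (T : K) : 0 < T -> has_derivative f f' ->
  {within `[0, T], continuous f}.
Proof.
move=> T0 [f0 df].
have fc t : 0 < t -> {for t, continuous f}.
  move=> t0; apply: differentiable_continuous.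
  by apply/derivable1_diffP; have := df t t0 => -[].
apply/continuous_within_itvP => //; split => //.
  by move=> t; rewrite in_itv/= => /andP[t0 _]; exact: fc.
exact/cvg_at_left_filter/fc.
Qed.

(** The function [f t * expR (- L * t)] is nonincreasing on [[0, T]] and starts at zero, so
    [f T <= 0]. *)
Lemma gronwall_eq0 f f' (L T : K) : has_derivative f f' -> 0 <= T ->
  f 0 = 0 -> 0 <= f T -> (forall t, 0 < t <= T -> f' t <= L * f t) -> f T = 0.
Proof.
move=> df; rewrite le_eqVlt => /predU1P[<-//|T0] f0 fT f'f.
have de : has_derivative (fun t => expR (- L * t)) (fun t => expR (- L * t) * - L).
  split=> [|t t0].
    apply: cvg_at_right_filter; apply: continuous_comp; last exact: continuous_expR.
    exact: mulrl_continuous.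
  apply: is_derive1_comp.
  by apply: (is_derive_eq (is_deriveZ _ _ )); rewrite /GRing.scale/= mulr1.
have dh := has_derivativeM df de.
have [h0 dh'] := dh.
have hT : f T * expR (- L * T) <= f 0 * expR (- L * 0).
  apply: (@ler0_derive1_nincr _ (fun t => f t * expR (- L * t)) 0 T) => //.
  - by move=> t; rewrite in_itv/= => /andP[t0 _]; have [] := dh' t t0.
  - move=> t; rewrite in_itv/= => /andP[t0 tT].
    rewrite derive1E; have [_ ->] := dh' t t0.
    have := f'f t; rewrite t0 (ltW tT) => /(_ isT).
    by have := expR_ge0 (- L * t); nra.
  - exact: has_derivative_continuous dh.
  - exact: ltW.
apply/eqP; rewrite eq_le fT andbT.
by move: hT; rewrite f0 mul0r pmulr_lle0// expR_gt0.
Qed.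

End ScalarDerivation.

(** * Derivatives of matrix functions *)

Section MatrixDerivation.
Variable K : realType.

Definition has_mx_derivative m n (X X' : K -> 'M[K]_(m, n)) :=
  forall i j, has_derivative (fun t => X t i j) (fun t => X' t i j).

Lemma has_mx_derivative_cst m n (M : 'M[K]_(m, n)) :
  has_mx_derivative (fun=> M) (fun=> 0).
Proof.
move=> i j; under [X in has_derivative _ X]eq_fun do rewrite mxE.
exact: has_derivative_cst.
Qed.

Lemma has_mx_derivativeD m n (X X' Y Y' : K -> 'M[K]_(m, n)) :
  has_mx_derivative X X' -> has_mx_derivative Y Y' ->
  has_mx_derivative (fun t => X t + Y t) (fun t => X' t + Y' t).
Proof.
move=> dX dY i j; under eq_fun do rewrite mxE.
under [X in has_derivative _ X]eq_fun do rewrite mxE.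
exact: has_derivativeD.
Qed.

Lemma has_mx_derivative_linear m n p q
    (f : {linear 'M[K]_(m, n) -> 'M[K]_(p, q)}) (X X' : K -> 'M[K]_(m, n)) :
  has_mx_derivative X X' ->
  has_mx_derivative (fun t => f (X t)) (fun t => f (X' t)).
Proof.
move=> dX i j; under eq_fun do rewrite linear_mx_entry.
under [X in has_derivative _ X]eq_fun do rewrite linear_mx_entry.
apply: has_derivative_sum => k; apply: has_derivative_sum => l.
have := has_derivativeM (dX k l) (has_derivative_cst (f (delta_mx k l) i j)).
by under [X in has_derivative _ X -> _]eq_fun do rewrite mulr0 addr0.
Qed.

Lemma has_mx_derivativeB m n (X X' Y Y' : K -> 'M[K]_(m, n)) :
  has_mx_derivative X X' -> has_mx_derivative Y Y' ->
  has_mx_derivative (fun t => X t - Y t) (fun t => X' t - Y' t).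
Proof.
move=> dX dY; apply: has_mx_derivativeD => //.
exact: (has_mx_derivative_linear -%R dY).
Qed.

Lemma has_mx_derivative_trmx m n (X X' : K -> 'M[K]_(m, n)) :
  has_mx_derivative X X' -> has_mx_derivative (fun t => (X t)^T) (fun t => (X' t)^T).
Proof. exact: has_mx_derivative_linear. Qed.

Lemma has_mx_derivativeM m n p (X X' : K -> 'M[K]_(m, n)) (Y Y' : K -> 'M[K]_(n, p)) :
  has_mx_derivative X X' -> has_mx_derivative Y Y' ->
  has_mx_derivative (fun t => X t *m Y t) (fun t => X' t *m Y t + X t *m Y' t).
Proof.
move=> dX dY i j; under eq_fun do rewrite mxE.
under [X in has_derivative _ X]eq_fun do rewrite !mxE -big_split/=.
by apply: has_derivative_sum => k; exact: has_derivativeM.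
Qed.

(** Right continuity at zero comes from the right derivative: [X h] is [h] times the difference
    quotient, plus [X 0]. *)
Lemma ode_solution_derivative n F X0 (X : K -> 'M[K]_n) :
  ode_solution F X0 X -> has_mx_derivative X (fun t => F t (X t)).
Proof.
move=> [_ X0' dX] i j; split=> [|t t0].
  have Xcvg : X h @[h --> 0^'+] --> X 0.
    have : h *: (h^-1 *: (X h - X 0)) + X 0 @[h --> 0^'+] --> 0 *: F 0 (X 0) + X 0.
      apply: cvgD; last exact: cvg_cst.
      by apply: cvgZ => //; apply: cvg_at_right_filter; exact: cvg_id.
    rewrite scale0r add0r; apply: cvg_trans; apply: near_eq_cvg.
    near=> h; have h0 : 0 < h by near: h; exact: nbhs_right_gt.
    by rewrite scalerA divff ?gt_eqF// scale1r subrK.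
  exact: (cvg_comp _ _ Xcvg (@coord_continuous _ _ _ i j (X 0))).
have [Xt XtE] := dX t t0; split; first by have /derivable_mxP := Xt; exact.
by rewrite -XtE derive_mx// mxE.
Unshelve. all: by end_near. Qed.

Definition bounded_upto (T : K) m n (X : K -> 'M[K]_(m, n)) :=
  exists2 c, 0 <= c & forall t, 0 < t <= T -> `|X t| <= c.

(** Used with [X] the derivative of [Z], as the linear growth hypothesis of Gronwall's argument.
    Time zero is excluded because derivatives are unconstrained there. *)
Definition dominated_upto (T : K) m n p q
    (Z : K -> 'M[K]_(m, n)) (X : K -> 'M[K]_(p, q)) :=
  exists2 L, 0 <= L & forall t, 0 < t <= T -> `|X t| <= L * `|Z t|.

(** * Gronwall's argument for matrix functions *)

Section Sumsq.
Variables (m n : nat) (X X' : K -> 'M[K]_(m, n)).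
Hypothesis dX : has_mx_derivative X X'.

(** The squared Frobenius norm, which unlike the maximum norm is differentiable along [X]. *)
Definition sumsq (M : 'M[K]_(m, n)) := \sum_i \sum_j M i j * M i j.

Lemma sumsq_ge0 M : 0 <= sumsq M.
Proof.
by apply: sumr_ge0 => i _; apply: sumr_ge0 => j _; rewrite -expr2 sqr_ge0.
Qed.

Lemma mx_norm_sumsq M : `|M| ^+ 2 <= sumsq M.
Proof.
rewrite -[leRHS]sqr_sqrtr ?sumsq_ge0// lerXn2r ?nnegrE ?sqrtr_ge0//.
apply: mx_norm_le => [|i j]; rewrite ?sqrtr_ge0//.
rewrite -sqrtr_sqr ler_sqrt ?sumsq_ge0// /sumsq (bigD1 i)//= (bigD1 j)//=.
rewrite -expr2 -addrA lerDl addr_ge0 ?sumr_ge0// => k _; rewrite -?expr2 ?sqr_ge0//.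
by apply: sumr_ge0 => l _; rewrite -expr2 sqr_ge0.
Qed.

Lemma has_derivative_sumsq : has_derivative (fun t => sumsq (X t))
  (fun t => \sum_i \sum_j (X' t i j * X t i j + X t i j * X' t i j)).
Proof.
by apply: has_derivative_sum => i; apply: has_derivative_sum => j;
  exact: has_derivativeM.
Qed.

Lemma has_mx_derivative_bounded T : bounded_upto T X.
Proof.
have [T0|T0] := ltP 0 T; last first.
  by exists 0 => // t /andP[t0 tT]; have := lt_le_trans t0 (le_trans tT T0);
    rewrite ltxx.
have [c _ cmax] := EVT_max (ltW T0) (has_derivative_continuous T0 has_derivative_sumsq).
(* The inequality [x <= 1 + x ^ 2] turns the bound on the square into a bound on the norm. *)
exists (1 + sumsq (X c)); first by rewrite addr_ge0 ?sumsq_ge0.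
move=> t /andP[t0 tT]; have := cmax t; rewrite in_itv/= (ltW t0) tT => /(_ isT).
have := mx_norm_sumsq (X t); have := sqr_ge0 (`|X t| - 1).
by have := normr_ge0 (X t); nra.
Qed.

Lemma mx_gronwall_eq0 : X 0 = 0 ->
  (forall T, dominated_upto T X X') -> forall t, 0 <= t -> X t = 0.
Proof.
move=> X0 domX T T0; have [L L0 LX] := domX T.
have sT : sumsq (X T) = 0.
  (* Each of the [m * n] terms of the derivative of [sumsq (X t)] is at most
     [2 * L * sumsq (X t)]. *)
  apply: (gronwall_eq0 (L := m%:R * (n%:R * (2 * L))) has_derivative_sumsq T0).
  - by rewrite X0 /sumsq big1// => i _; rewrite big1// => j _; rewrite mxE mul0r.
  - exact: sumsq_ge0.
  move=> t tT; have Xt := LX t tT.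
  have XX' i j : X' t i j * X t i j + X t i j * X' t i j <= 2 * L * sumsq (X t).
    have : `|X' t i j * X t i j| <= L * `|X t| ^+ 2.
      rewrite normrM expr2 mulrA ler_pM// ?mx_norm_entry//.
      exact: le_trans (mx_norm_entry _ _ _) Xt.
    have := ler_wpM2l L0 (mx_norm_sumsq (X t)).
    have := ler_norm (X' t i j * X t i j); rewrite [X t i j * _]mulrC.
    lra.
  rewrite -!mulrA mulr_natl -[m in _ *+ m]card_ord -sumr_const ler_sum// => i _.
  rewrite mulr_natl -[n in _ *+ n]card_ord -sumr_const ler_sum// => j _.
  by rewrite mulrA.
have := mx_norm_sumsq (X T); rewrite sT exprn_even_le0//= normr_eq0.
by move/eqP.
Qed.

End Sumsq.

(** * Closure rules for bounds on finite time intervals *)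

Section Bounded.
Variable T : K.

Lemma bounded_upto_cst m n (M : 'M[K]_(m, n)) : bounded_upto T (fun=> M).
Proof. by exists `|M|. Qed.

Lemma bounded_uptoD m n (X Y : K -> 'M[K]_(m, n)) :
  bounded_upto T X -> bounded_upto T Y -> bounded_upto T (fun t => X t + Y t).
Proof.
move=> [c c0 Xc] [d d0 Yd]; exists (c + d) => [|t tT]; first exact: addr_ge0.
by rewrite (le_trans (ler_normD _ _))// lerD// (Xc, Yd).
Qed.

Lemma bounded_uptoN m n (X : K -> 'M[K]_(m, n)) :
  bounded_upto T X -> bounded_upto T (fun t => - X t).
Proof. by move=> [c c0 Xc]; exists c => // t tT; rewrite normrN Xc. Qed.

Lemma bounded_upto_trmx m n (X : K -> 'M[K]_(m, n)) :
  bounded_upto T X -> bounded_upto T (fun t => (X t)^T).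
Proof. by move=> [c c0 Xc]; exists c => // t tT; rewrite mx_norm_trmx Xc. Qed.

Lemma bounded_uptoM m n p (X : K -> 'M[K]_(m, n)) (Y : K -> 'M[K]_(n, p)) :
  bounded_upto T X -> bounded_upto T Y -> bounded_upto T (fun t => X t *m Y t).
Proof.
move=> [c c0 Xc] [d d0 Yd]; exists (n%:R * (c * d)) => [|t tT].
  by rewrite !mulr_ge0.
by rewrite (le_trans (mx_norm_mul _ _))// ler_wpM2l// ler_pM// (Xc, Yd).
Qed.

Variables (a b : nat) (Z : K -> 'M[K]_(a, b)).

Lemma dominated_upto_refl : dominated_upto T Z Z.
Proof. by exists 1 => // t _; rewrite mul1r. Qed.

Lemma dominated_uptoD m n (X Y : K -> 'M[K]_(m, n)) :
  dominated_upto T Z X -> dominated_upto T Z Y ->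
  dominated_upto T Z (fun t => X t + Y t).
Proof.
move=> [c c0 Xc] [d d0 Yd]; exists (c + d) => [|t tT]; first exact: addr_ge0.
by rewrite (le_trans (ler_normD _ _))// mulrDl lerD// (Xc, Yd).
Qed.

Lemma dominated_uptoN m n (X : K -> 'M[K]_(m, n)) :
  dominated_upto T Z X -> dominated_upto T Z (fun t => - X t).
Proof. by move=> [c c0 Xc]; exists c => // t tT; rewrite normrN Xc. Qed.

Lemma dominated_upto_linear m n p q (f : {linear 'M[K]_(m, n) -> 'M[K]_(p, q)})
    (X : K -> 'M[K]_(m, n)) :
  dominated_upto T Z X -> dominated_upto T Z (fun t => f (X t)).
Proof.
have [d d0 fd] := linear_mx_bounded f.
move=> [c c0 Xc]; exists (d * c) => [|t tT]; first exact: mulr_ge0.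
by rewrite (le_trans (fd _))// -mulrA ler_wpM2l// Xc.
Qed.

Lemma dominated_uptoMl m n p (X : K -> 'M[K]_(m, n)) (Y : K -> 'M[K]_(n, p)) :
  bounded_upto T X -> dominated_upto T Z Y ->
  dominated_upto T Z (fun t => X t *m Y t).
Proof.
move=> [c c0 Xc] [d d0 Yd]; exists (n%:R * (c * d)) => [|t tT].
  by rewrite !mulr_ge0.
rewrite (le_trans (mx_norm_mul _ _))// -!mulrA ler_wpM2l// ler_pM// (Xc, Yd)//.
Qed.

Lemma dominated_uptoMr m n p (X : K -> 'M[K]_(m, n)) (Y : K -> 'M[K]_(n, p)) :
  dominated_upto T Z X -> bounded_upto T Y ->
  dominated_upto T Z (fun t => X t *m Y t).
Proof.
move=> [d d0 Xd] [c c0 Yc]; exists (n%:R * (d * c)) => [|t tT].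
  by rewrite !mulr_ge0.
rewrite (le_trans (mx_norm_mul _ _))// -mulrA ler_wpM2l// mulrAC.
by rewrite ler_pM// (Xd, Yc).
Qed.

Lemma eq_dominated_upto m n (X Y : K -> 'M[K]_(m, n)) :
  X =1 Y -> dominated_upto T Z X -> dominated_upto T Z Y.
Proof. by move=> /funext ->. Qed.

End Bounded.

End MatrixDerivation.

(** * Riccati flows *)

Section RiccatiFlows.
Variables (K : realType) (n : nat).
Implicit Types (A R S Q P : 'M[K]_n) (X Y E : K -> 'M[K]_n).

(** The difference [Z = X - Y] solves a linear equation with bounded coefficients, because
    [X S X - Y S Y = Z S X + Y S Z]. *)
Lemma Ricc_solution_unique A R S X Y :
  has_mx_derivative X (fun t => Ricc A R S (X t)) ->
  has_mx_derivative Y (fun t => Ricc A R S (Y t)) ->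
  X 0 = Y 0 -> forall t, 0 <= t -> X t = Y t.
Proof.
move=> dX dY XY0 t t0; apply/subr0_eq; move: t t0.
apply: (mx_gronwall_eq0 (has_mx_derivativeB dX dY)) => [|T].
  by rewrite XY0 subrr.
pose Z t := X t - Y t.
apply: (@eq_dominated_upto _ _ _ _ _ _ _
  (fun t => A *m Z t + Z t *m A^T + - (Z t *m (S *m X t) + Y t *m S *m Z t))).
  by move=> t; rewrite /Z /Ricc; mx_linear.
have bX := has_mx_derivative_bounded dX T.
have bY := has_mx_derivative_bounded dY T.
have bA := bounded_upto_cst T A; have bAT := bounded_upto_cst T A^T.
have bS := bounded_upto_cst T S; have ZZ := dominated_upto_refl T Z.
apply: dominated_uptoD; first apply: dominated_uptoD.
- exact: dominated_uptoMl.
- exact: dominated_uptoMr.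
apply: dominated_uptoN; apply: dominated_uptoD.
  by apply: dominated_uptoMr => //; exact: bounded_uptoM.
by apply: dominated_uptoMl => //; exact: bounded_uptoM.
Qed.

Variable pi : {linear 'M[K]_n -> 'M[K]_n}.

(* The antisymmetric part [Z] satisfies a linear equation because
   [pi X - (pi X)^T] depends only on [pi Z]. *)
Lemma Ricc_pi_solution_sym A R S X :
  (forall Q, Q^T = Q -> (pi Q)^T = pi Q) -> R^T = R -> S^T = S ->
  has_mx_derivative X (fun t => Ricc_pi pi A R S (X t)) ->
  (X 0)^T = X 0 -> forall t, 0 <= t -> (X t)^T = X t.
Proof.
move=> piT RT ST dX X0T t t0; apply/esym/subr0_eq; move: t t0.
apply: (mx_gronwall_eq0 (has_mx_derivativeB dX (has_mx_derivative_trmx dX))) => [|T].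
  by rewrite X0T subrr.
pose Z t := X t - (X t)^T; pose Y t := pi (X t).
pose V t := pi (Z t) - (pi (Z t))^T.
have YE t : Y t - (Y t)^T = 2^-1 *: V t.
  (* [U] is the symmetric part of [X t]; its image under [pi] is symmetric and drops out of
     [Y t - (Y t)^T]. *)
  pose U := 2^-1 *: (X t + (X t)^T).
  have UT : (pi U)^T = pi U by apply: piT; rewrite linearZ/= linearD/= trmxK addrC.
  have -> : Y t = pi U + 2^-1 *: pi (Z t).
    rewrite /Y -linearZ -linearD; congr (pi _); rewrite /U /Z scalerDr scalerBr.
    by mx_linear.
  by rewrite [(pi U + _)^T]linearD/= UT [(_ *: _)^T]linearZ/= /V scalerBr; mx_linear.
apply: (@eq_dominated_upto _ _ _ _ _ _ _
  (fun t => (A - Y t *m S) *m Z t + Z t *m (A - Y t *m S)^T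
   + (2^-1 *: V t *m (S *m Y t) + (Y t)^T *m S *m (2^-1 *: V t)))).
  move=> t; rewrite -YE /Ricc_pi -/(Y t) /Z.
  by rewrite !(trmx_add, trmx_opp, trmx_mul, trmxK) RT ST; mx_linear.
have bX := has_mx_derivative_bounded dX T.
have bY : bounded_upto T Y.
  exact: has_mx_derivative_bounded (has_mx_derivative_linear pi dX) T.
have bA := bounded_upto_cst T A; have bS := bounded_upto_cst T S.
have bAY : bounded_upto T (fun t => A - Y t *m S).
  by apply: bounded_uptoD => //; apply: bounded_uptoN; exact: bounded_uptoM.
have ZZ := dominated_upto_refl T Z.
have ZpiZ : dominated_upto T Z (fun t => pi (Z t)) by exact: dominated_upto_linear.
have ZV : dominated_upto T Z (fun t => 2^-1 *: V t).
  apply: dominated_upto_linear; apply: dominated_uptoD => //.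
  by apply: dominated_uptoN; exact: dominated_upto_linear.
apply: dominated_uptoD; apply: dominated_uptoD.
- exact: dominated_uptoMl.
- by apply: dominated_uptoMr => //; exact: bounded_upto_trmx.
- by apply: dominated_uptoMr => //; exact: bounded_uptoM.
- apply: dominated_uptoMl => //; apply: bounded_uptoM => //.
  exact: bounded_upto_trmx.
Qed.

(** For [p = pi X] symmetric and [b = A - p S], one has [Ricc_pi X - Ricc p = b (X - p) + (X - p)
    b^T]. The conjugate [E W E^T] solves the same linear equation with the same initial value. *)
Lemma Ricc_pi_solution_conj A R S X E :
  S^T = S -> (forall t, 0 <= t -> (pi (X t))^T = pi (X t)) ->
  has_mx_derivative X (fun t => Ricc_pi pi A R S (X t)) ->
  has_mx_derivative (fun t => pi (X t)) (fun t => Ricc A R S (pi (X t))) ->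
  has_mx_derivative E (fun t => (A - pi (X t) *m S) *m E t) -> E 0 = 1%:M ->
  forall t, 0 <= t ->
    X t = pi (X t) + E t *m (X 0 - pi (X 0)) *m (E t)^T.
Proof.
move=> ST YT dX dY dE E0 t t0; set W := X 0 - _.
apply/subr0_eq; rewrite opprD addrA; move: t t0.
have dEW := has_mx_derivativeM dE (has_mx_derivative_cst W).
have dEWE := has_mx_derivativeM dEW (has_mx_derivative_trmx dE).
apply: (mx_gronwall_eq0 (has_mx_derivativeB (has_mx_derivativeB dX dY) dEWE)) => [|T].
  by rewrite E0 trmx1 mul1mx mulmx1 subrr.
pose Z t := X t - pi (X t) - E t *m W *m (E t)^T.
pose b t := A - pi (X t) *m S.
have : dominated_upto T Z (fun t => b t *m Z t + Z t *m (b t)^T).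
  have bb : bounded_upto T b.
    apply: bounded_uptoD; first exact: bounded_upto_cst.
    apply: bounded_uptoN; apply: bounded_uptoM; last exact: bounded_upto_cst.
    exact: has_mx_derivative_bounded dY T.
  have ZZ := dominated_upto_refl T Z.
  apply: dominated_uptoD; first exact: dominated_uptoMl.
  by apply: dominated_uptoMr => //; exact: bounded_upto_trmx.
move=> [L L0 ZL]; exists L => // t tT; have /= := ZL t tT.
congr (`|_| <= _); rewrite /Z /b /Ricc_pi /Ricc.
have /andP[/ltW/YT pT _] := tT; move: pT; set p := pi (X t) => pT.
rewrite !(trmx_add, trmx_opp, trmx_mul) pT ST.
by mx_linear.
Qed.

End RiccatiFlows.

Lemma expR_decay_le0 (K : realType) (x c a : K) : 0 < a ->
  (forall t, 0 <= t -> x <= c * expR (- (a * t))) -> x <= 0.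
Proof.
move=> a0 xc; rewrite leNgt; apply/negP => x0.
have c0 : 0 < c.
  by have := xc 0 (lexx _); rewrite mulr0 oppr0 expR0 mulr1; exact: lt_le_trans.
(* At time [t = c / (x a)], the bound [1 + u <= expR u] gives [x * expR (a * t) >= x + c > c], a
   contradiction. *)
have t0 : 0 <= c / x / a by rewrite !divr_ge0// ltW.
have := xc _ t0; rewrite [a * _]mulrC divfK ?gt_eqF// expRN.
rewrite ler_pdivlMr ?expR_gt0// leNgt => /negP; apply.
have := ler_wpM2l (ltW x0) (expR_ge1Dx (c / x)).
by rewrite mulrDr mulr1 [x * (c / x)]mulrC divfK ?gt_eqF//; lra.
Qed.

(** * The stability estimate *)

Lemma mx_norm_mul3 (K : realType) n (X Y Z : 'M[K]_n) x y z :
  `|X| <= x -> `|Y| <= y -> `|Z| <= z ->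
  `|X *m Y *m Z| <= n%:R ^+ 2 * (x * y * z).
Proof.
move=> Xx Yy Zz; rewrite (le_trans (mx_norm_mul _ _))// expr2 -mulrA ler_wpM2l//.
rewrite mulrA ler_pM// (le_trans (mx_norm_mul _ _))// ler_wpM2l// ler_pM//.
Qed.

(** Here [e] stands for the decay factor, [d] and [D] for the distances between the projections and
    between the initial values, [a] and [b] for bounds on the transition matrices up to [e], [k] and
    [l] for the Lipschitz constants of [E] and [phi], and [w] for the size of [Q1 - pi Q1]. The term
    in [e ^ 2 * d] is absorbed thanks to [e <= 1]. *)
Lemma contraction_bound (K : realType) (e d D a b k w l N : K) :
  0 <= e -> e <= 1 -> 0 <= d -> 0 <= D -> 0 <= a -> 0 <= b -> 0 <= k ->
  0 <= w -> 0 <= l -> 0 <= N ->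
  l * e * d + (N * (b * e * (D + d) * (b * e)) + N * (k * d * w * (b * e))
    + N * (a * e * w * (k * d)))
  <= (l + N * (b ^+ 2 + k * w * (a + b))) * (e * (d + e * D)).
Proof.
move=> e0 e1 d0 D0 a0 b0 k0 w0 l0 N0; rewrite -subr_ge0.
rewrite [leRHS](_ : _ = l * e * (e * D) + N * (b ^+ 2 * e * (1 - e) * d)
    + N * (k * w * (a + b) * e * (e * D))); last by ring.
have : 0 <= 1 - e by rewrite subr_ge0.
by move: (1 - e) => f f0; rewrite !(addr_ge0, mulr_ge0).
Qed.

Theorem theorem2p13 (K : realType) (r r' : nat)
  (A : 'M[K]_r) (C : 'M[K]_(r', r)) (R : 'M[K]_r) (Sigma : 'M[K]_r')
  (S Rhalf P : 'M[K]_r)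
  (phi E phipi : K -> 'M[K]_r -> 'M[K]_r) (nu : K)
  (B : set 'M[K]_r) (pi : {linear 'M[K]_r -> 'M[K]_r})
  (R_posdef : posdef R) (Sigma_posdef : posdef Sigma)
  (S_def : S = C^T *m invmx Sigma *m C)
  (Rhalf_psd : psd Rhalf) (Rhalf_sqr : Rhalf *m Rhalf = R)
  (AR_controllable : controllable A Rhalf) (AC_observable : observable A C)
  (phi_flow : is_flow (Ricc A R S) phi)
  (P_posdef : posdef P) (P_fixed : Ricc A R S P = 0)
  (E_def : is_transition A S phi E)
  (nu_rate : is_rate phi E nu)
  (phipi_flow : is_flow (Ricc_pi pi A R S) phipi)
  (B_ring : matrix_ring B)
  (pi_positive : forall Q : 'M[K]_r, psd Q -> psd (pi Q))
  (pi_idem : forall Q : 'M[K]_r, pi (pi Q) = pi Q)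
  (pi_range : range pi = B)
  (pi_compat : forall Q b : 'M[K]_r, B b ->
     pi (b *m (Q - pi Q) + (Q - pi Q) *m b) = 0)
  (BA : B A) (BAT : B A^T) (BR : B R) (BS : B S) :
  exists kappa : K -> K -> K,
    [/\ forall Q1 Q2, psd Q1 -> psd Q2 -> forall t : K, 0 <= t ->
          spectral_norm (phipi t Q2 - phipi t Q1)
          <= kappa (spectral_norm Q1) (spectral_norm Q2)
             * expR (- (2 * nu * t))
             * (spectral_norm (pi Q2 - pi Q1)
                + expR (- (2 * nu * t)) * spectral_norm (Q2 - Q1)),
        exists Ppi, [/\ psd Ppi,
          forall t : K, 0 <= t -> phipi t Ppi = Ppi,
          forall Q, psd Q -> (forall t : K, 0 <= t -> phipi t Q = Q) -> Q = Ppi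
          & pi Ppi = P]
      & forall Q, psd Q -> forall t : K, 0 <= t ->
          spectral_norm (pi (phipi t Q) - phipi t Q)
          <= kappa (spectral_norm Q) (spectral_norm (pi Q))
             * expR (- (4 * nu * t))
             * spectral_norm (pi Q - Q)].
Proof.
have ST : S^T = S.
  by rewrite S_def !trmx_mul trmx_inv Sigma_posdef.1 trmxK mulmxA.
have [[B0 BB'] BM'] := B_ring.
have BB b c : B b -> B c -> B (b - c).
  by move=> Bb Bc; have := BB' b c; rewrite !inE; exact.
have BM b c : B b -> B c -> B (b *m c).
  by move=> Bb Bc; have := BM' b c; rewrite !inE; exact.
have pi_in Q : B (pi Q) by rewrite -pi_range; exists Q.
have pi_id b : B b -> pi b = b by rewrite -pi_range => -[Q _ <-].
have piT := positive_trmx pi_positive.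
have dphi Q : psd Q -> has_mx_derivative (phi^~ Q) (fun t => Ricc A R S (phi t Q)).
  by move=> /phi_flow/ode_solution_derivative.
have dphipi Q : psd Q ->
    has_mx_derivative (phipi^~ Q) (fun t => Ricc_pi pi A R S (phipi t Q)).
  by move=> /phipi_flow/ode_solution_derivative.
have phipiT Q : psd Q -> forall t, 0 <= t -> (phipi t Q)^T = phipi t Q.
  move=> Q0; apply: (Ricc_pi_solution_sym piT R_posdef.1 ST (dphipi Q Q0)).
  by have [-> _ _] := phipi_flow Q Q0; exact: Q0.1.
have dpi Q : psd Q -> has_mx_derivative (fun t => pi (phipi t Q))
    (fun t => Ricc A R S (pi (phipi t Q))).
  move=> Q0; have d := has_mx_derivative_linear pi (dphipi Q Q0).
  (* The intertwining relation needs [phipi t Q] symmetric, which is known for nonnegative times;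
     hence the derivative is rewritten pointwise at [t > 0]. *)
  move=> i j; have [d0 dt] := d i j; split=> // t t0.
  rewrite -(projection_Ricc_pi BB BM pi_in pi_id pi_positive pi_compat)//.
    exact: dt.
  by apply: phipiT => //; exact: ltW.
have piphi Q : psd Q -> forall t, 0 <= t -> pi (phipi t Q) = phi t (pi Q).
  move=> Q0; apply: (Ricc_solution_unique (dpi Q Q0) (dphi _ (pi_positive Q Q0))).
  have [-> _ _] := phipi_flow Q Q0.
  by have [-> _ _] := phi_flow _ (pi_positive Q Q0).
have phipiE Q : psd Q -> forall t, 0 <= t -> phipi t Q =
    phi t (pi Q) + E t (pi Q) *m (Q - pi Q) *m (E t (pi Q))^T.
  move=> Q0 t t0; have piQ0 := pi_positive Q Q0.
  have [E0 _ _] := E_def _ piQ0; have [X0 _ _] := phipi_flow Q Q0.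
  have dE : has_mx_derivative (E^~ (pi Q))
      (fun s => (A - pi (phipi s Q) *m S) *m E s (pi Q)).
    have d := ode_solution_derivative (E_def _ piQ0).
    move=> i j; have [d0 dt] := d i j; split=> // s s0.
    by rewrite piphi// ?ltW//; exact: dt.
  have pT s : 0 <= s -> (pi (phipi s Q))^T = pi (phipi s Q).
    by move=> s0; apply: piT; exact: phipiT.
  have := Ricc_pi_solution_conj ST pT (dphipi Q Q0) (dpi Q Q0) dE E0 t0.
  by rewrite X0 piphi.
have P_psd : psd P.
  split=> [|x]; first exact: P_posdef.1.
  have [->|/P_posdef.2/ltW//] := eqVneq x 0.
  by rewrite mulmx0 mxE.
have phiP t : 0 <= t -> phi t P = P.
  have [P0 _ _] := phi_flow P P_psd.
  apply: (Ricc_solution_unique (Y := fun=> P) (dphi P P_psd)) => //.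
  by rewrite P_fixed; exact: has_mx_derivative_cst.
have [nu0 [kE1 [kE2 [kphi [[kE1_mono kE2_mono kphi_mono] rate]]]]] := nu_rate.
have [c c0 pic] := linear_mx_bounded pi.
have snormE := @spectral_norm_ge K r; have snormN := @spectral_norm_le K r.
have mul3 := @mx_norm_mul3 K r.
have := sqr_ge0 (r%:R : K); move: (r%:R ^+ 2) snormN mul3 => N snormN mul3 N0.
(* A bound for [pi] in the spectral norm: it lets constants evaluated at the norm of [pi Q] be
   replaced, by monotonicity, with constants depending on the norm of [Q]. Absolute values ensure
   nonnegativity below. *)
pose q := N * c.
have snorm0 (M : 'M[K]_r) : 0 <= spectral_norm M := le_trans (normr_ge0 _) (snormE M).
pose kE q1 := `|kE1 (q * q1)|.
pose k2 q1 q2 := `|kE2 (q * q1) (q * q2)|.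
pose kp q1 q2 := `|kphi (q * q1) (q * q2)|.
have kE_ge0 q1 : 0 <= kE q1 by exact: normr_ge0.
have k2_ge0 q1 q2 : 0 <= k2 q1 q2 by exact: normr_ge0.
have kp_ge0 q1 q2 : 0 <= kp q1 q2 by exact: normr_ge0.
pose kappa1 q1 q2 := N * (kp q1 q2
  + N * (kE q2 ^+ 2 + k2 q1 q2 * ((1 + c) * q1) * (kE q1 + kE q2))).
have kappa1_ge0 q1 q2 : 0 <= q1 -> 0 <= kappa1 q1 q2.
  move=> q10; apply: mulr_ge0 => //; apply: addr_ge0 => //; apply: mulr_ge0 => //.
  apply: addr_ge0; first exact: sqr_ge0.
  by rewrite !mulr_ge0// addr_ge0.
(* [kappa1] serves the contraction estimate and the added term the last one, where the second
   argument is already the norm of [pi Q]. *)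
pose kappa q1 q2 := kappa1 q1 q2 + N ^+ 2 * kE1 q2 ^+ 2.
have snorm_pi M : spectral_norm (pi M) <= q * spectral_norm M.
  rewrite (le_trans (snormN _))// /q -mulrA ler_wpM2l// (le_trans (pic _))//.
  by rewrite ler_wpM2l.
pose e t := expR (- (2 * nu * t)).
have e0 t : 0 <= e t by exact: expR_ge0.
have e1 t : 0 <= t -> e t <= 1.
  by move=> t0; rewrite -expR0 ler_expR oppr_le0 !mulr_ge0// ltW.
have contraction Q1 Q2 t : psd Q1 -> psd Q2 -> 0 <= t ->
    spectral_norm (phipi t Q2 - phipi t Q1)
    <= kappa1 (spectral_norm Q1) (spectral_norm Q2) * e t
       * (spectral_norm (pi Q2 - pi Q1) + e t * spectral_norm (Q2 - Q1)).
  move=> Q10 Q20 t0; have p1 := pi_positive _ Q10; have p2 := pi_positive _ Q20.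
  set q1 := spectral_norm Q1; set q2 := spectral_norm Q2.
  have r1 : spectral_norm (pi Q1) <= q * q1 by exact: snorm_pi.
  have r2 : spectral_norm (pi Q2) <= q * q2 by exact: snorm_pi.
  have [F1 phiD ED] := rate _ _ p1 p2 t t0; have [F2 _ _] := rate _ _ p2 p1 t t0.
  have {}F1 : `|E t (pi Q1)| <= kE q1 * e t.
    rewrite (le_trans (snormE _))// (le_trans F1)// ler_wpM2r//.
    by rewrite (le_trans (kE1_mono _ _ _ r1))// ler_norm.
  have {}F2 : `|E t (pi Q2)| <= kE q2 * e t.
    rewrite (le_trans (snormE _))// (le_trans F2)// ler_wpM2r//.
    by rewrite (le_trans (kE1_mono _ _ _ r2))// ler_norm.
  set d := spectral_norm (pi Q2 - pi Q1) in phiD ED *.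
  set D := spectral_norm (Q2 - Q1).
  have d0 : 0 <= d by exact: snorm0.
  have D0 : 0 <= D by exact: snorm0.
  have {}phiD : `|phi t (pi Q2) - phi t (pi Q1)| <= kp q1 q2 * e t * d.
    rewrite (le_trans (snormE _))// (le_trans phiD)// -/(e t) -!mulrA.
    rewrite ler_wpM2r ?mulr_ge0//.
    by rewrite (le_trans (kphi_mono _ _ _ _ _ _ r1 r2))// ler_norm.
  (* The decay of this difference is bounded by one: in each product where it occurs, the other
     transition matrix supplies the factor [e t]. *)
  have {}ED : `|E t (pi Q2) - E t (pi Q1)| <= k2 q1 q2 * d.
    rewrite (le_trans (snormE _))// (le_trans ED)// ler_wpM2r//.
    apply: (@le_trans _ _ (k2 q1 q2 * expR (- (nu * t)))).
      rewrite ler_wpM2r ?expR_ge0//.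
      by rewrite (le_trans (kE2_mono _ _ _ _ _ _ r1 r2))// ler_norm.
    by rewrite ler_piMr// -expR0 ler_expR oppr_le0 mulr_ge0// ltW.
  have W1 : `|Q1 - pi Q1| <= (1 + c) * q1.
    rewrite (le_trans (ler_normB _ _))// mulrDl mul1r lerD//.
    by rewrite (le_trans (pic _))// ler_wpM2l.
  have W21 : `|(Q2 - pi Q2) - (Q1 - pi Q1)| <= D + d.
    have -> : (Q2 - pi Q2) - (Q1 - pi Q1) = (Q2 - Q1) - (pi Q2 - pi Q1).
      by mx_linear.
    by rewrite (le_trans (ler_normB _ _))// lerD.
  have ET1 : `|(E t (pi Q1))^T| <= kE q1 * e t by rewrite mx_norm_trmx.
  have ET2 : `|(E t (pi Q2))^T| <= kE q2 * e t by rewrite mx_norm_trmx.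
  have ETD : `|(E t (pi Q2) - E t (pi Q1))^T| <= k2 q1 q2 * d.
    by rewrite mx_norm_trmx.
  rewrite (le_trans (snormN _))// /kappa1 -!(mulrA N) ler_wpM2l// -(mulrA _ (e t)).
  have w0 : 0 <= (1 + c) * q1 by rewrite mulr_ge0 ?addr_ge0 ?snorm0.
  apply: le_trans (contraction_bound (e0 t) (e1 t t0) d0 D0 (kE_ge0 q1)
    (kE_ge0 q2) (k2_ge0 q1 q2) w0 (kp_ge0 q1 q2) N0).
  rewrite (phipiE _ Q10 _ t0) (phipiE _ Q20 _ t0).
  (* Telescoping the conjugates yields one difference per product, matching term by term the left
     side of [contraction_bound]. *)
  have -> : forall X1 X2 F1 F2 V1 V2 : 'M[K]_r,
      X2 + F2 *m V2 *m F2^T - (X1 + F1 *m V1 *m F1^T) = (X2 - X1)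
      + (F2 *m (V2 - V1) *m F2^T + (F2 - F1) *m V1 *m F2^T
         + F1 *m V1 *m (F2 - F1)^T).
    by move=> X1 X2 V1 V2 G1 G2; rewrite trmx_add trmx_opp; mx_linear.
  rewrite (le_trans (ler_normD _ _))// lerD//.
  rewrite (le_trans (ler_normD _ _))// lerD//; last exact: mul3.
  by rewrite (le_trans (ler_normD _ _))// lerD//; exact: mul3.
have fixed_unique Q1 Q2 : psd Q1 -> psd Q2 ->
    (forall t, 0 <= t -> phipi t Q1 = Q1) ->
    (forall t, 0 <= t -> phipi t Q2 = Q2) -> Q2 = Q1.
  move=> Q10 Q20 fix1 fix2; apply/subr0_eq/eqP; rewrite -normr_le0.
  apply: (@expR_decay_le0 _ _ (kappa1 (spectral_norm Q1) (spectral_norm Q2) *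
    (spectral_norm (pi Q2 - pi Q1) + spectral_norm (Q2 - Q1))) (2 * nu)) => [|t t0].
    exact: mulr_gt0.
  have := contraction Q1 Q2 t Q10 Q20 t0; rewrite fix1// fix2//.
  move=> /(le_trans (snormE _))/le_trans; apply.
  have := kappa1_ge0 _ (spectral_norm Q2) (snorm0 Q1).
  (* One factor [e t] is kept to force the constant distance to zero; the inner one is bounded by
     one. *)
  move: (kappa1 _ _) => k k0; rewrite -/(e t) -!mulrA ler_wpM2l// mulrC.
  by rewrite ler_wpM2r// lerD2l ler_piMl// e1.
have piP : pi P = P.
  have piP_psd := pi_positive _ P_psd.
  apply/subr0_eq/eqP; rewrite -normr_le0.
  apply: (@expR_decay_le0 _ _ ((c + 1) * (`|kphi (spectral_norm (pi P))
    (spectral_norm P)| * spectral_norm (P - pi P))) (2 * nu)) => [|t t0].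
    exact: mulr_gt0.
  have [_ +_] := rate _ _ piP_psd P_psd t t0.
  rewrite phiP// -(piphi _ P_psd _ t0); set Y := phipi t P => PY.
  have {}PY : `|P - pi Y| <= `|kphi (spectral_norm (pi P)) (spectral_norm P)|
      * spectral_norm (P - pi P) * e t.
    rewrite (le_trans (snormE _))// (le_trans PY)// -/(e t) mulrAC.
    by rewrite !ler_wpM2r// ler_norm.
  (* By idempotence the terms in [pi Y] cancel, so the constant [pi P - P] is controlled by
     [P - pi Y], which decays. *)
  have -> : pi P - P = pi (P - pi Y) - (P - pi Y).
    by rewrite linearB/= pi_idem; mx_linear.
  rewrite (le_trans (ler_normB _ _))// -/(e t) -(mulrA _ _ (e t)) mulrDl mul1r.
  rewrite lerD//.
  by rewrite (le_trans (pic _))// ler_wpM2l.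
have phipiP t : 0 <= t -> phipi t P = P.
  by move=> t0; rewrite phipiE// piP phiP// subrr mulmx0 mul0mx addr0.
exists kappa; split.
- move=> Q1 Q2 Q10 Q20 t t0; apply: (le_trans (contraction _ _ _ Q10 Q20 t0)).
  apply: ler_wpM2r; first by rewrite addr_ge0// mulr_ge0.
  by apply: ler_wpM2r => //; rewrite lerDl mulr_ge0 ?sqr_ge0.
- exists P; split=> // Q Q0 fixQ.
  exact: fixed_unique.
- move=> Q Q0 t t0; have p0 := pi_positive _ Q0.
  (* What remains is exactly the conjugate of [Q - pi Q]; each of its two transition matrices
     contributes a factor [e t], whence the rate [4 * nu]. *)
  rewrite (piphi _ Q0 _ t0) (phipiE _ Q0 _ t0) opprD addNKr.
  rewrite (le_trans (snormN _))// normrN.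
  have [F _ _] := rate _ _ p0 p0 t t0.
  have {}F : `|E t (pi Q)| <= kE1 (spectral_norm (pi Q)) * e t.
    exact: le_trans (snormE _) F.
  have FT : `|(E t (pi Q))^T| <= kE1 (spectral_norm (pi Q)) * e t.
    by rewrite mx_norm_trmx.
  have W : `|Q - pi Q| <= spectral_norm (pi Q - Q) by rewrite distrC.
  rewrite (le_trans (ler_wpM2l N0 (mul3 _ _ _ _ _ _ F W FT)))//.
  have -> : expR (- (4 * nu * t)) = e t ^+ 2.
    by rewrite -expRM_natl; congr expR; ring.
  set k := kE1 _; set w := spectral_norm (pi Q - Q).
  rewrite /kappa -subr_ge0 [leRHS](_ : _ =
    kappa1 (spectral_norm Q) (spectral_norm (pi Q)) * e t ^+ 2 * w); last first.
    by rewrite -/k; ring.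
  apply: mulr_ge0; last exact: snorm0.
  apply: mulr_ge0; last exact: sqr_ge0.
  exact: kappa1_ge0.
Qed.
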